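(* If $z_0>0$, then there exist $R>0$ and a function $z\in C^2([0,R])$, $z>0$, which is a solution of $$\frac{z}{2}\left(\frac{z''}{(1+z'^2)^{3/2}}+\frac{z'}{r(1+z'^2)^{1/2}}\right)+\frac{1}{(1+z'^2)^{1/2}}=\frac{1}{z(1+z'^2)^{1/2}}$$ with initial conditions $z(0)=z_0$, $z'(0)=0$.
   Context: The unknown is $z=z(r)$ and primes denote derivatives with respect to $r$. The equation is singular at $r=0$; being a solution means that the equation holds for all $r\in(0,R]$, together with the initial conditions at $r=0$. *)

(* Defs.v *)
From Stdlib Require Import Reals.
Local Open Scope R_scope.

Definition cc_interval (a b x : R) : Prop := a <= x <= b.

(* [f] is of class C^2 on the closed interval [a, b], with first and second
   derivatives [f1] and [f2].  Stdlib's [D_in] and [continue_in] take limits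
   within the given set, so they are one-sided at the endpoints and do not
   depend on the values of the functions outside [a, b].  For a < b the values
   of [f1] and [f2] on [a, b] are determined by [f].  Continuity of [f] and
   [f1] follows from differentiability. *)
Definition C2_on (a b : R) (f f1 f2 : R -> R) : Prop :=
  forall x : R, cc_interval a b x ->
    D_in f f1 (cc_interval a b) x /\
    D_in f1 f2 (cc_interval a b) x /\
    continue_in f2 (cc_interval a b) x.

(* Main.v *)
Require Import Defs.
From Stdlib Require Import Reals.
From Stdlib Require Import Lra Psatz.
From Coquelicot Require Import Coquelicot.
Local Open Scope R_scope.

(** Multiplied by [(1 + z'^2)^(1/2)], the equation reads
    [z'' / (1 + z'^2) + z' / r = g(z)] with [g(z) = 2 / z^2 - 2 / z].  In terms
    of [q = z' / r] it becomes
      [(r^2 q)' = r F(r, z, q)],  [F(r, z, q) = (1 + r^2 q^2) g(z) - r^2 q^3],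
    in which the coefficient [1 / r] has disappeared from the right side.
    A solution is therefore a fixed point of
      [q(r) = r^-2 \int_0^r s F(s, z(s), q(s)) ds],
      [z(r) = z0 + \int_0^r s q(s) ds].
    The operator [h |-> r^-2 \int_0^r s h(s) ds] halves sup norms and maps
    continuous functions to continuous functions, with value [h(0) / 2] at the
    origin ([radial_mean_close], [radial_mean_continuity]).  Moreover [F]
    depends on [q] only through terms carrying a factor [r^2], and [z] depends
    on [q] with the same gain of [r^2].  So once [F] is bounded and Lipschitz
    the fixed point operator is a contraction on a short interval
    ([singular_picard]).

    Boundedness and the Lipschitz property are forced by truncating [q] to
    [[-M, M]] and [z] to [[z0 / 2, 2 z0]]; the bound on [F] shows that on a
    short interval the solution stays within these ranges.

    Finally [r^2 q = \int_0^r s h] gives [(r q)' = h - q], also at the origin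
    where [q(0) = h(0) / 2] ([slope_derive]).  Hence [z'' = h - q] is continuous
    up to the origin, and [h = F(r, z, q)] is the equation. *)

(** * Continuity *)

Lemma continuity_add (f g : R -> R) :
  continuity f -> continuity g -> continuity (fun x => f x + g x).
Proof. exact (continuity_plus f g). Qed.

Lemma continuity_sub (f g : R -> R) :
  continuity f -> continuity g -> continuity (fun x => f x - g x).
Proof. exact (continuity_minus f g). Qed.

Lemma continuity_mul (f g : R -> R) :
  continuity f -> continuity g -> continuity (fun x => f x * g x).
Proof. exact (continuity_mult f g). Qed.

Lemma continuity_cst (c : R) : continuity (fun _ => c).
Proof. apply continuity_const; intros x y; reflexivity. Qed.

Lemma continuity_idfun : continuity (fun x => x).
Proof. exact (derivable_continuous id derivable_id). Qed.

Lemma continuity_compose (f g : R -> R) :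
  continuity f -> continuity g -> continuity (fun x => g (f x)).
Proof. exact (continuity_comp f g). Qed.

Lemma continuity_reciprocal (f : R -> R) :
  continuity f -> (forall x, f x <> 0) -> continuity (fun x => / f x).
Proof. intros Hf Hn; exact (continuity_inv f Hf Hn). Qed.

Lemma continuity_power (f : R -> R) (n : nat) :
  continuity f -> continuity (fun x => f x ^ n).
Proof.
  intros Hf; induction n as [|n IH]; simpl.
  - apply continuity_cst.
  - apply continuity_mul; assumption.
Qed.

Lemma continuity_pt_eps (f : R -> R) (x : R) :
  (forall eps, 0 < eps -> exists d, 0 < d /\
     forall y, Rabs (y - x) < d -> Rabs (f y - f x) < eps) <->
  continuity_pt f x.
Proof.
  rewrite continuity_pt_locally; split.
  - intros H eps.
    destruct (H eps (cond_pos eps)) as [d [Hd Hy]].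
    exists (mkposreal d Hd); intros y Hyd; apply Hy; exact Hyd.
  - intros H eps Heps.
    destruct (H (mkposreal eps Heps)) as [d Hd].
    exists d; split; [apply cond_pos|].
    intros y Hy; apply (Hd y); exact Hy.
Qed.

(** * Truncation *)

Definition clamp (a b x : R) : R := Rmax a (Rmin b x).

Lemma clamp_range (a b x : R) : a <= b -> a <= clamp a b x <= b.
Proof.
  intros H; unfold clamp; split; [apply Rmax_l|].
  apply Rmax_lub; [exact H | apply Rmin_l].
Qed.

Lemma clamp_id (a b x : R) : a <= x <= b -> clamp a b x = x.
Proof.
  intros [Ha Hb]; unfold clamp; rewrite Rmin_right, Rmax_right; lra.
Qed.

Lemma clamp_abs (b x : R) : 0 <= b -> Rabs (clamp (- b) b x) <= b.
Proof. intros H; apply Rabs_le; apply clamp_range; lra. Qed.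

Lemma clamp_lipschitz (a b x y : R) :
  Rabs (clamp a b x - clamp a b y) <= Rabs (x - y).
Proof.
  unfold clamp, Rmax, Rmin.
  repeat destruct Rle_dec; unfold Rabs; repeat destruct Rcase_abs; lra.
Qed.

Lemma clamp_continuity (a b : R) : continuity (clamp a b).
Proof.
  intros x; apply continuity_pt_eps; intros eps Heps; exists eps; split; auto.
  intros y Hy; eapply Rle_lt_trans; [apply clamp_lipschitz | exact Hy].
Qed.

(** * Contractions of the space of bounded continuous functions *)

Lemma half_pow_small (K eps : R) :
  0 <= K -> 0 < eps -> exists n : nat, K * (/ 2) ^ n < eps.
Proof.
  intros HK Heps.
  assert (Hh : Rabs (/ 2) < 1) by (rewrite Rabs_pos_eq; lra).
  destruct (pow_lt_1_zero (/ 2) Hh (eps / (K + 1))) as [N HN].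
  { apply Rdiv_lt_0_compat; lra. }
  exists N; specialize (HN N (Nat.le_refl N)).
  assert (Hp : 0 < (/ 2) ^ N) by (apply pow_lt; lra).
  rewrite Rabs_pos_eq in HN by lra.
  apply Rmult_lt_compat_r with (r := K + 1) in HN; [|lra].
  replace (eps / (K + 1) * (K + 1)) with eps in HN by (field; lra).
  nra.
Qed.

(** Banach's fixed point theorem in the supremum norm.  The range of [T] being
    uniformly bounded makes the first increment bounded, which lets the domain
    be all continuous functions on the line. *)
Lemma contraction_fixed_point (T : (R -> R) -> R -> R) (K : R) :
  0 <= K ->
  (forall f, continuity f -> continuity (T f)) ->
  (forall f, continuity f -> forall x, Rabs (T f x) <= K) ->
  (forall f g d, continuity f -> continuity g ->
     (forall x, Rabs (f x - g x) <= d) ->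
     forall x, Rabs (T f x - T g x) <= d / 2) ->
  exists f, continuity f /\ forall x, f x = T f x.
Proof.
  intros HK Hcont Hbound Hcontr.
  set (u := fix u (n : nat) : R -> R :=
              match n with O => fun _ => 0 | S n => T (u n) end).
  assert (Hu : forall n, continuity (u n)).
  { induction n as [|n IH]; [apply continuity_cst | apply Hcont, IH]. }
  (* All iterates lie within K of the initial function 0; applying T to this
     bound n times gives the Cauchy estimate without any geometric series. *)
  assert (Hcau : forall n k x, Rabs (u (n + k)%nat x - u n x) <= K * (/ 2) ^ n).
  { induction n as [|n IH]; intros k x.
    - simpl. rewrite Rminus_0_r, Rmult_1_r.
      destruct k as [|k]; simpl; [rewrite Rabs_R0; exact HK|].
      apply Hbound, Hu.
    - simpl plus; simpl u.
      replace (K * (/ 2) ^ S n) with (K * (/ 2) ^ n / 2) by (simpl; field).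
      apply Hcontr; auto. }
  assert (Hlim : forall x, ex_finite_lim_seq (fun n => u n x)).
  { intros x; apply ex_lim_seq_cauchy_corr; intros eps.
    destruct (half_pow_small K (eps / 2) HK) as [N HN].
    { pose proof (cond_pos eps); lra. }
    exists N; intros n m Hn Hm.
    pose proof (Hcau N (n - N)%nat x) as H1.
    pose proof (Hcau N (m - N)%nat x) as H2.
    replace (N + (n - N))%nat with n in H1 by lia.
    replace (N + (m - N))%nat with m in H2 by lia.
    apply Rabs_le_between in H1; apply Rabs_le_between in H2.
    apply Rabs_lt_between; lra. }
  set (f := fun x => real (Lim_seq (fun n => u n x))).
  assert (Hf : forall n x, Rabs (f x - u n x) <= K * (/ 2) ^ n).
  { intros n x.
    assert (H : is_lim_seq (fun k => Rabs (u (k + n)%nat x - u n x))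
                  (Rabs (f x - u n x))).
    { apply (is_lim_seq_abs _ (Finite (f x - u n x))).
      apply is_lim_seq_minus'; [|apply is_lim_seq_const].
      apply (is_lim_seq_incr_n (fun n => u n x)), Lim_seq_correct', Hlim. }
    refine (is_lim_seq_le _ _ (Finite _) (Finite _) _ H
              (is_lim_seq_const (K * (/ 2) ^ n))).
    intros k; simpl; rewrite Nat.add_comm; apply Hcau. }
  assert (Hfc : continuity f).
  { intros x; apply continuity_pt_eps; intros eps Heps.
    destruct (half_pow_small K (eps / 3) HK) as [n Hn]; [lra|].
    destruct (proj2 (continuity_pt_eps (u n) x) (Hu n x) (eps / 3))
      as [d [Hd Hy]]; [lra|].
    exists d; split; [exact Hd|]; intros y Hyd; specialize (Hy y Hyd).
    pose proof (Hf n x) as H1; pose proof (Hf n y) as H2.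
    apply Rabs_le_between in H1; apply Rabs_le_between in H2.
    apply Rabs_lt_between in Hy; apply Rabs_lt_between; lra. }
  exists f; split; [exact Hfc|]; intros x.
  apply cond_eq; intros eps Heps.
  destruct (half_pow_small K eps HK Heps) as [n Hn].
  assert (Hp : 0 < (/ 2) ^ n) by (apply pow_lt; lra).
  pose proof (Hf (S n) x) as H1.
  pose proof (Hcontr f (u n) _ Hfc (Hu n) (Hf n) x) as H2.
  simpl in H1.
  apply Rabs_le_between in H1; apply Rabs_le_between in H2.
  apply Rabs_lt_between; lra.
Qed.

(** * Radial means *)

Definition moment (h : R -> R) (r : R) : R := RInt (fun s => s * h s) 0 r.

Lemma moment_integrand_continuity (h : R -> R) :
  continuity h -> continuity (fun s => s * h s).
Proof. intros Hh; apply continuity_mul; [apply continuity_idfun | exact Hh]. Qed.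

Lemma ex_RInt_continuity (f : R -> R) (a b : R) : continuity f -> ex_RInt f a b.
Proof.
  intros Hf; apply (@ex_RInt_continuous R_CompleteNormedModule); intros x _.
  apply continuity_pt_filterlim, Hf.
Qed.

Lemma moment_0 (h : R -> R) : moment h 0 = 0.
Proof. unfold moment; rewrite RInt_point; reflexivity. Qed.

Lemma moment_derive (h : R -> R) (r : R) :
  continuity h -> is_derive (moment h) r (r * h r).
Proof.
  intros Hh.
  apply (is_derive_RInt (fun s => s * h s) (moment h) 0).
  - apply filter_forall; intros b; apply (@RInt_correct R_CompleteNormedModule).
    apply ex_RInt_continuity, moment_integrand_continuity, Hh.
  - apply continuity_pt_filterlim, (moment_integrand_continuity h Hh).
Qed.

Lemma moment_continuity (h : R -> R) : continuity h -> continuity (moment h).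
Proof.
  intros Hh r; apply continuity_pt_filterlim.
  apply (@ex_derive_continuous R_AbsRing R_NormedModule).
  exists (r * h r); apply moment_derive, Hh.
Qed.

Lemma is_RInt_moment_cst (c r : R) :
  is_RInt (fun s => s * c) 0 r (c * (r ^ 2 / 2)).
Proof.
  replace (c * (r ^ 2 / 2)) with (minus (r ^ 2 / 2 * c) (0 ^ 2 / 2 * c))
    by (unfold minus, plus, opp; simpl; field).
  apply (@is_RInt_derive R_CompleteNormedModule (fun s => s ^ 2 / 2 * c)).
  - intros s _; auto_derive; [exact I | field].
  - intros s _; apply continuity_pt_filterlim.
    apply continuity_mul; [apply continuity_idfun | apply continuity_cst].
Qed.

Lemma moment_close (f g : R -> R) (d r : R) :
  continuity f -> continuity g -> 0 <= r ->
  (forall s, 0 <= s <= r -> Rabs (f s - g s) <= d) ->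
  Rabs (moment f r - moment g r) <= d * (r ^ 2 / 2).
Proof.
  intros Hf Hg Hr Hd.
  apply (@norm_RInt_le R_NormedModule (fun s => s * f s - s * g s)
           (fun s => s * d) 0 r); [exact Hr| | |].
  - intros s Hs; change (norm ?x) with (Rabs x).
    rewrite <- Rmult_minus_distr_l, Rabs_mult, (Rabs_pos_eq s) by lra.
    apply Rmult_le_compat_l; [lra | apply Hd, Hs].
  - apply (@is_RInt_minus R_NormedModule);
      apply (@RInt_correct R_CompleteNormedModule), ex_RInt_continuity,
        moment_integrand_continuity; assumption.
  - apply is_RInt_moment_cst.
Qed.

Lemma moment_cst (c r : R) : moment (fun _ => c) r = c * (r ^ 2 / 2).
Proof. apply is_RInt_unique, is_RInt_moment_cst. Qed.

Lemma moment_abs (h : R -> R) (K r : R) :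
  continuity h -> 0 <= r -> (forall s, 0 <= s <= r -> Rabs (h s) <= K) ->
  Rabs (moment h r) <= K * (r ^ 2 / 2).
Proof.
  intros Hh Hr HK.
  rewrite <- (Rminus_0_r (moment h r)).
  replace 0 with (moment (fun _ => 0) r) by (rewrite moment_cst; ring).
  apply moment_close; [exact Hh | apply continuity_cst | exact Hr |].
  intros s Hs; rewrite Rminus_0_r; apply HK, Hs.
Qed.

(** Half the average of [h] over the disc of radius [|r|], for [h] read as a
    radial function in the plane; the absolute value makes it an even
    function, so that continuity at the singular point is two-sided. *)
Definition radial_mean (h : R -> R) (r : R) : R :=
  if Req_EM_T r 0 then h 0 / 2 else moment h (Rabs r) / r ^ 2.

Lemma radial_mean_0 (h : R -> R) : radial_mean h 0 = h 0 / 2.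
Proof. unfold radial_mean; destruct Req_EM_T; [reflexivity | contradiction]. Qed.

Lemma radial_mean_pos (h : R -> R) (r : R) :
  0 < r -> radial_mean h r = moment h r / r ^ 2.
Proof.
  intros Hr; unfold radial_mean; destruct Req_EM_T; [lra|].
  rewrite Rabs_pos_eq; [reflexivity | lra].
Qed.

Lemma radial_mean_close (f g : R -> R) (d r : R) :
  continuity f -> continuity g ->
  (forall s, 0 <= s <= Rabs r -> Rabs (f s - g s) <= d) ->
  Rabs (radial_mean f r - radial_mean g r) <= d / 2.
Proof.
  intros Hf Hg Hd; unfold radial_mean; destruct Req_EM_T as [Hr|Hr].
  - specialize (Hd 0); assert (H : Rabs (f 0 - g 0) <= d).
    { apply Hd; split; [lra | apply Rabs_pos]. }
    apply Rabs_le_between in H; apply Rabs_le_between; lra.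
  - pose proof (moment_close f g d (Rabs r) Hf Hg (Rabs_pos r) Hd) as H.
    assert (Hr2 : 0 < r ^ 2) by (rewrite <- Rsqr_pow2; apply Rsqr_pos_lt, Hr).
    rewrite pow2_abs in H.
    replace (moment f (Rabs r) / r ^ 2 - moment g (Rabs r) / r ^ 2)
      with ((moment f (Rabs r) - moment g (Rabs r)) / r ^ 2) by (field; exact Hr).
    rewrite Rabs_div by lra; rewrite (Rabs_pos_eq (r ^ 2)) by lra.
    apply Rle_div_l; [exact Hr2 | lra].
Qed.

Lemma radial_mean_cst (c r : R) : radial_mean (fun _ => c) r = c / 2.
Proof.
  unfold radial_mean; destruct Req_EM_T as [Hr|Hr]; [reflexivity|].
  rewrite moment_cst, pow2_abs; field; exact Hr.
Qed.

Lemma radial_mean_abs (h : R -> R) (K r : R) :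
  continuity h -> (forall s, 0 <= s <= Rabs r -> Rabs (h s) <= K) ->
  Rabs (radial_mean h r) <= K / 2.
Proof.
  intros Hh HK.
  replace (radial_mean h r) with (radial_mean h r - radial_mean (fun _ => 0) r)
    by (rewrite radial_mean_cst; field).
  apply radial_mean_close; [exact Hh | apply continuity_cst |].
  intros s Hs; rewrite Rminus_0_r; apply HK, Hs.
Qed.

Lemma radial_mean_continuity (h : R -> R) :
  continuity h -> continuity (radial_mean h).
Proof.
  intros Hh r; destruct (Req_dec r 0) as [->|Hr].
  - (* Near 0 the mean of [h] is close to the mean of the constant [h 0]. *)
    apply continuity_pt_eps; intros eps Heps.
    destruct (proj2 (continuity_pt_eps h 0) (Hh 0) eps Heps) as [d [Hd Hy]].
    exists d; split; [exact Hd|]; intros y Hyd.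
    rewrite Rminus_0_r in Hyd.
    rewrite radial_mean_0, <- (radial_mean_cst (h 0) y).
    apply Rle_lt_trans with (eps / 2); [|lra].
    apply radial_mean_close; [exact Hh | apply continuity_cst |].
    intros s Hs; left; apply Hy.
    rewrite Rminus_0_r, Rabs_pos_eq; lra.
  - apply (continuity_pt_ext_loc (fun r => moment h (Rabs r) * / r ^ 2)).
    + assert (Hp : 0 < Rabs r) by (apply Rabs_pos_lt, Hr).
      exists (mkposreal _ Hp); intros y Hy.
      unfold radial_mean; destruct Req_EM_T as [Hy0|Hy0]; [exfalso|reflexivity].
      subst y; unfold ball in Hy; simpl in Hy.
      unfold AbsRing_ball, abs, minus, plus, opp in Hy; simpl in Hy.
      rewrite Rplus_0_l, Rabs_Ropp in Hy; lra.
    + apply (continuity_pt_mult (fun r => moment h (Rabs r)) (fun r => / r ^ 2)).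
      * apply (continuity_compose Rabs (moment h));
          [exact Rcontinuity_abs | apply moment_continuity, Hh].
      * apply (continuity_pt_inv (fun r => r ^ 2)).
        -- apply (continuity_power (fun r => r)), continuity_idfun.
        -- apply pow_nonzero, Hr.
Qed.

(** * The singular initial value problem with a bounded Lipschitz right side *)

(** The operator is [q |-> radial_mean (F s (z0 + moment q s) (q s))].  If two
    inputs are at distance [d], the moments differ by at most [d rho^2 / 2], so
    the values of [F] differ by at most [3 L rho^2 d / 2 <= d], and the mean
    halves this.  The first argument of [F] is clamped to [[0, rho]] so that
    these estimates hold on the whole line. *)
Lemma singular_picard (F : R -> R -> R -> R) (z0 K L rho : R) :
  0 < rho -> 0 <= K -> 0 <= L -> 3 * L * rho ^ 2 <= 2 ->
  (forall s z q : R -> R, continuity s -> continuity z -> continuity q ->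
     continuity (fun r => F (s r) (z r) (q r))) ->
  (forall s z q, 0 <= s <= rho -> Rabs (F s z q) <= K) ->
  (forall s z q z' q', 0 <= s <= rho ->
     Rabs (F s z q - F s z' q') <= L * (Rabs (z - z') + s ^ 2 * Rabs (q - q'))) ->
  exists q h : R -> R,
    continuity q /\ continuity h /\
    (forall r, 0 <= r <= rho -> h r = F r (z0 + moment q r) (q r)) /\
    (forall r, q r = radial_mean h r) /\
    (forall r, Rabs (q r) <= K / 2).
Proof.
  intros Hrho HK HL Hsmall HFc HFK HFL.
  set (c := clamp 0 rho).
  assert (Hc : forall s, 0 <= c s <= rho) by (intros s; apply clamp_range; lra).
  assert (Hcc : continuity c) by apply clamp_continuity.
  set (H := fun (q : R -> R) s => F (c s) (z0 + moment q (c s)) (q s)).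
  assert (HHc : forall q, continuity q -> continuity (H q)).
  { intros q Hq; apply HFc; [exact Hcc | | exact Hq].
    apply continuity_add; [apply continuity_cst|].
    apply (continuity_compose c (moment q)); [exact Hcc|].
    apply moment_continuity, Hq. }
  assert (HHK : forall q s, Rabs (H q s) <= K) by (intros q s; apply HFK, Hc).
  destruct (contraction_fixed_point (fun q => radial_mean (H q)) (K / 2))
    as [q [Hq Hfix]].
  - lra.
  - intros q Hq; apply radial_mean_continuity, HHc, Hq.
  - intros q Hq x; apply radial_mean_abs; [apply HHc, Hq | intros; apply HHK].
  - intros f g d Hf Hg Hd x.
    apply radial_mean_close; [apply HHc, Hf | apply HHc, Hg |].
    intros s _.
    eapply Rle_trans; [apply HFL, Hc|].
    assert (Hm : Rabs (z0 + moment f (c s) - (z0 + moment g (c s)))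
                 <= d * (c s ^ 2 / 2)).
    { replace (z0 + moment f (c s) - (z0 + moment g (c s)))
        with (moment f (c s) - moment g (c s)) by ring.
      apply moment_close; [exact Hf | exact Hg | apply Hc | intros; apply Hd]. }
    assert (Hd0 : 0 <= d) by (eapply Rle_trans; [apply Rabs_pos | apply (Hd 0)]).
    assert (Hc2 : c s ^ 2 <= rho ^ 2) by (apply pow_incr, Hc).
    assert (Hc0 : 0 <= c s ^ 2) by apply pow2_ge_0.
    apply Rle_trans with (L * (3 / 2 * rho ^ 2 * d)); [|nra].
    apply Rmult_le_compat_l; [exact HL|].
    pose proof (Rmult_le_compat_l _ _ _ Hc0 (Hd s)).
    pose proof (Rmult_le_compat_r _ _ _ Hd0 Hc2).
    lra.
  - exists q, (H q); split; [exact Hq|]; split; [apply HHc, Hq|].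
    split; [|split; [exact Hfix|]].
    + intros r Hr; unfold H, c; rewrite (clamp_id 0 rho r Hr); reflexivity.
    + intros r; rewrite Hfix.
      apply radial_mean_abs; [apply HHc, Hq | intros; apply HHK].
Qed.

(** * Regularity of the resulting profile *)

Lemma is_derive_D_in (f f' : R -> R) (D : R -> Prop) (x : R) :
  is_derive f x (f' x) -> D_in f f' D x.
Proof.
  intros H; apply is_derive_Reals in H; intros eps Heps.
  destruct (H eps Heps) as [d Hd]; exists d; split; [apply cond_pos|].
  intros y [[_ Hne] Hy]; simpl in Hy |- *; unfold Rdist in *.
  replace y with (x + (y - x)) at 1 by ring.
  apply Hd; lra.
Qed.

Lemma continuity_continue_in (f : R -> R) (D : R -> Prop) (x : R) :
  continuity_pt f x -> continue_in f D x.
Proof.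
  intros H eps Heps; destruct (H eps Heps) as [d [Hd Hy]].
  exists d; split; [exact Hd|]; intros y [[_ Hne] Hyd]; apply Hy.
  split; [split; [exact I | exact Hne] | exact Hyd].
Qed.

(** Off the origin this is the quotient rule; at the origin the difference
    quotient of [r q(r)] is [q(r)] itself, whose limit is [h(0)/2]. *)
Lemma slope_derive (q h : R -> R) (r : R) :
  continuity q -> continuity h -> (forall r, q r = radial_mean h r) -> 0 <= r ->
  is_derive (fun s => s * q s) r (h r - q r).
Proof.
  intros Hq Hh Hqh Hr; destruct (Req_dec r 0) as [->|Hn].
  - apply is_derive_Reals; intros eps Heps.
    destruct (proj2 (continuity_pt_eps q 0) (Hq 0) eps Heps) as [d [Hd Hy]].
    exists (mkposreal d Hd); intros t Ht Htd; simpl in Htd.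
    replace (((0 + t) * q (0 + t) - 0 * q 0) / t - (h 0 - q 0))
      with (q t - q 0).
    + apply Hy; rewrite Rminus_0_r; exact Htd.
    + rewrite (Hqh 0), radial_mean_0, Rplus_0_l; field; exact Ht.
  - assert (Hp : 0 < r) by lra.
    apply (is_derive_ext_loc (fun s => moment h s / s)).
    + exists (mkposreal r Hp); intros y Hy.
      apply Rabs_lt_between' in Hy; simpl in Hy.
      change (@eq R (moment h y / y) (y * q y)).
      rewrite Hqh, radial_mean_pos by lra; field; lra.
    + replace (h r - q r) with ((r * h r * r - moment h r * 1) / r ^ 2).
      * apply (is_derive_div (moment h) (fun s => s)).
        -- apply moment_derive, Hh.
        -- apply (@is_derive_id R_AbsRing).
        -- exact Hn.
      * rewrite Hqh, radial_mean_pos by exact Hp; field; exact Hn.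
Qed.

(** * The truncated equation *)

(** This is [(1 + s^2 q^2) g(z) - s^2 q^3] with [g(z) = 2 / z^2 - 2 / z], once
    [|q| <= M] and [z0 / 2 <= z <= 2 z0]. *)
Definition trunc_rhs (z0 M s z q : R) : R :=
  (1 + s ^ 2 * clamp (- M) M q ^ 2)
    * (2 * (/ clamp (z0 / 2) (2 * z0) z) ^ 2 - 2 * / clamp (z0 / 2) (2 * z0) z)
  - s ^ 2 * clamp (- M) M q ^ 3.

Lemma trunc_rhs_continuity (z0 M : R) (s z q : R -> R) :
  0 < z0 -> continuity s -> continuity z -> continuity q ->
  continuity (fun r => trunc_rhs z0 M (s r) (z r) (q r)).
Proof.
  intros Hz0 Hs Hz Hq; unfold trunc_rhs.
  assert (Hcq : continuity (fun r => clamp (- M) M (q r)))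
    by (apply continuity_compose; [exact Hq | apply clamp_continuity]).
  assert (Hcz : continuity (fun r => / clamp (z0 / 2) (2 * z0) (z r))).
  { apply continuity_reciprocal.
    - apply continuity_compose; [exact Hz | apply clamp_continuity].
    - intros r; pose proof (clamp_range (z0 / 2) (2 * z0) (z r)); lra. }
  repeat first [ apply continuity_sub | apply continuity_add
               | apply continuity_mul | apply continuity_power
               | apply continuity_cst | assumption ].
Qed.

Lemma clamp_inv_range (z0 z : R) :
  0 < z0 -> 0 <= / clamp (z0 / 2) (2 * z0) z <= 2 / z0.
Proof.
  intros Hz0; pose proof (clamp_range (z0 / 2) (2 * z0) z) as H.
  split.
  - left; apply Rinv_0_lt_compat; lra.
  - replace (2 / z0) with (/ (z0 / 2)) by (field; lra).
    apply Rinv_le_contravar; lra.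
Qed.

(** Both truncated values are at least [z0 / 2], so the difference of their
    reciprocals gains a factor [1 / (z0 / 2)^2]. *)
Lemma clamp_inv_lipschitz (z0 z z' : R) :
  0 < z0 ->
  Rabs (/ clamp (z0 / 2) (2 * z0) z - / clamp (z0 / 2) (2 * z0) z')
  <= (2 / z0) ^ 2 * Rabs (z - z').
Proof.
  intros Hz0.
  pose proof (clamp_range (z0 / 2) (2 * z0) z) as H.
  pose proof (clamp_range (z0 / 2) (2 * z0) z') as H'.
  pose proof (clamp_inv_range z0 z Hz0) as Hi.
  pose proof (clamp_inv_range z0 z' Hz0) as Hi'.
  pose proof (clamp_lipschitz (z0 / 2) (2 * z0) z' z) as Hl.
  rewrite (Rabs_minus_sym z' z) in Hl.
  set (m := clamp _ _ z) in *; set (m' := clamp _ _ z') in *.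
  replace (/ m - / m') with (/ m * / m' * (m' - m)) by (field; lra).
  rewrite Rabs_mult, (Rabs_pos_eq (/ m * / m')) by (apply Rmult_le_pos; lra).
  apply Rmult_le_compat; [apply Rmult_le_pos; lra | apply Rabs_pos | | exact Hl].
  simpl; rewrite Rmult_1_r; apply Rmult_le_compat; lra.
Qed.

Lemma quadratic_bound (a w : R) :
  0 <= w <= a -> Rabs (2 * w ^ 2 - 2 * w) <= 2 * a ^ 2 + 2 * a.
Proof. intros H; apply Rabs_le; nra. Qed.

Lemma quadratic_lipschitz (a w w' : R) :
  0 <= w <= a -> 0 <= w' <= a ->
  Rabs (2 * w ^ 2 - 2 * w - (2 * w' ^ 2 - 2 * w'))
  <= (4 * a + 2) * Rabs (w - w').
Proof.
  intros H H'.
  replace (2 * w ^ 2 - 2 * w - (2 * w' ^ 2 - 2 * w'))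
    with ((2 * (w + w') - 2) * (w - w')) by ring.
  rewrite Rabs_mult; apply Rmult_le_compat_r; [apply Rabs_pos|].
  apply Rabs_le; lra.
Qed.

Lemma pow2_lipschitz (M x y : R) :
  Rabs x <= M -> Rabs y <= M -> Rabs (x ^ 2 - y ^ 2) <= 2 * M * Rabs (x - y).
Proof.
  intros Hx Hy; apply Rabs_le_between in Hx; apply Rabs_le_between in Hy.
  replace (x ^ 2 - y ^ 2) with ((x + y) * (x - y)) by ring.
  rewrite Rabs_mult; apply Rmult_le_compat_r; [apply Rabs_pos|].
  apply Rabs_le; lra.
Qed.

Lemma pow3_lipschitz (M x y : R) :
  Rabs x <= M -> Rabs y <= M ->
  Rabs (x ^ 3 - y ^ 3) <= 3 * M ^ 2 * Rabs (x - y).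
Proof.
  intros Hx Hy; apply Rabs_le_between in Hx; apply Rabs_le_between in Hy.
  replace (x ^ 3 - y ^ 3) with ((x ^ 2 + x * y + y ^ 2) * (x - y)) by ring.
  rewrite Rabs_mult; apply Rmult_le_compat_r; [apply Rabs_pos|].
  apply Rabs_le; nra.
Qed.

(** Under [s M <= 1] the factor [s^2 q^2] is at most 1, which leaves
    [2 |g| + |q|]. *)
Lemma trunc_rhs_bound (z0 M s z q : R) :
  0 < z0 -> 0 <= M -> 0 <= s -> s * M <= 1 ->
  Rabs (trunc_rhs z0 M s z q) <= 2 * (2 * (2 / z0) ^ 2 + 2 * (2 / z0)) + M.
Proof.
  intros Hz0 HM Hs HsM; unfold trunc_rhs.
  pose proof (quadratic_bound _ _ (clamp_inv_range z0 z Hz0)) as Hg.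
  set (G := 2 * (2 / z0) ^ 2 + 2 * (2 / z0)) in *.
  set (g := 2 * _ ^ 2 - _) in *.
  pose proof (clamp_abs M q HM) as Hp; set (p := clamp _ _ q) in *.
  apply Rabs_le_between in Hp.
  assert (Hsp : (s * p) ^ 2 <= 1).
  { assert (-1 <= s * p <= 1) by (split; nra). nra. }
  assert (Hsp0 : 0 <= (s * p) ^ 2) by apply pow2_ge_0.
  replace ((1 + s ^ 2 * p ^ 2) * g - s ^ 2 * p ^ 3)
    with ((1 + (s * p) ^ 2) * g - (s * p) ^ 2 * p) by ring.
  set (t := (s * p) ^ 2) in *.
  apply Rabs_le_between in Hg; apply Rabs_le; split; nra.
Qed.

(** The increment in [q] must keep its factor [s^2]: that factor is what makes
    the fixed point operator contract on a short interval. *)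
Lemma trunc_rhs_lipschitz (z0 M s z q z' q' : R) :
  0 < z0 -> 0 <= M -> 0 <= s -> s * M <= 1 ->
  Rabs (trunc_rhs z0 M s z q - trunc_rhs z0 M s z' q')
  <= (2 * ((4 * (2 / z0) + 2) * (2 / z0) ^ 2)
      + 2 * M * (2 * (2 / z0) ^ 2 + 2 * (2 / z0)) + 3 * M ^ 2)
     * (Rabs (z - z') + s ^ 2 * Rabs (q - q')).
Proof.
  intros Hz0 HM Hs HsM; unfold trunc_rhs.
  pose proof (clamp_inv_range z0 z Hz0) as Hw.
  pose proof (clamp_inv_range z0 z' Hz0) as Hw'.
  pose proof (clamp_inv_lipschitz z0 z z' Hz0) as Hww.
  set (w := / clamp _ _ z) in *; set (w' := / clamp _ _ z') in *.
  set (a := 2 / z0) in *.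
  assert (Ha : 0 <= a) by lra.
  pose proof (quadratic_bound _ _ Hw) as Hg.
  pose proof (quadratic_lipschitz _ _ _ Hw Hw') as Hgg.
  set (g := 2 * w ^ 2 - _) in *; set (g' := 2 * w' ^ 2 - _) in *.
  pose proof (clamp_abs M q HM) as Hp.
  pose proof (clamp_abs M q' HM) as Hp'.
  pose proof (clamp_lipschitz (- M) M q q') as Hpp.
  set (p := clamp _ _ q) in *; set (p' := clamp _ _ q') in *.
  pose proof (pow2_lipschitz M p p' Hp Hp') as H2.
  pose proof (pow3_lipschitz M p p' Hp Hp') as H3.
  set (dz := Rabs (z - z')) in *; set (dq := Rabs (q - q')) in *.
  assert (Hdz : 0 <= dz) by apply Rabs_pos.
  assert (Hdq : 0 <= dq) by apply Rabs_pos.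
  set (G := 2 * a ^ 2 + 2 * a) in *.
  assert (HG : 0 <= G) by (eapply Rle_trans; [apply Rabs_pos | exact Hg]).
  set (l := (4 * a + 2) * a ^ 2).
  assert (Hl : 0 <= l) by (unfold l; nra).
  assert (Hs2 : 0 <= s ^ 2) by apply pow2_ge_0.
  assert (Hgl : Rabs (g - g') <= l * dz).
  { eapply Rle_trans; [exact Hgg|].
    unfold l; rewrite Rmult_assoc; apply Rmult_le_compat_l; [lra | exact Hww]. }
  assert (H2' : Rabs (p ^ 2 - p' ^ 2) <= 2 * M * dq).
  { eapply Rle_trans; [exact H2|]; apply Rmult_le_compat_l; lra. }
  assert (H3' : Rabs (p ^ 3 - p' ^ 3) <= 3 * M ^ 2 * dq).
  { eapply Rle_trans; [exact H3|]; apply Rmult_le_compat_l; [nra | exact Hpp]. }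
  assert (Hsp : Rabs (1 + s ^ 2 * p' ^ 2) <= 2).
  { apply Rabs_le_between in Hp'.
    assert (-1 <= s * p' <= 1) by (split; nra).
    apply Rabs_le; nra. }
  (* Change [g] with [p'] fixed, then the powers of [p] with [g] fixed. *)
  replace ((1 + s ^ 2 * p ^ 2) * g - s ^ 2 * p ^ 3
           - ((1 + s ^ 2 * p' ^ 2) * g' - s ^ 2 * p' ^ 3))
    with ((1 + s ^ 2 * p' ^ 2) * (g - g')
          + (s ^ 2 * ((p ^ 2 - p' ^ 2) * g) + - (s ^ 2 * (p ^ 3 - p' ^ 3)))) by ring.
  assert (E1 : Rabs ((1 + s ^ 2 * p' ^ 2) * (g - g')) <= 2 * (l * dz)).
  { rewrite Rabs_mult; apply Rmult_le_compat; auto using Rabs_pos. }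
  assert (E2 : Rabs (s ^ 2 * ((p ^ 2 - p' ^ 2) * g)) <= s ^ 2 * (2 * M * dq * G)).
  { rewrite Rabs_mult, (Rabs_pos_eq (s ^ 2)), Rabs_mult by exact Hs2.
    apply Rmult_le_compat_l; [exact Hs2|].
    apply Rmult_le_compat; auto using Rabs_pos. }
  assert (E3 : Rabs (- (s ^ 2 * (p ^ 3 - p' ^ 3))) <= s ^ 2 * (3 * M ^ 2 * dq)).
  { rewrite Rabs_Ropp, Rabs_mult, (Rabs_pos_eq (s ^ 2)) by exact Hs2.
    apply Rmult_le_compat_l; assumption. }
  eapply Rle_trans; [apply Rabs_triang|].
  eapply Rle_trans; [apply Rplus_le_compat_l, Rabs_triang|].
  assert (Hsd : 0 <= s ^ 2 * dq) by (apply Rmult_le_pos; assumption).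
  assert (HMG : 0 <= M * G) by (apply Rmult_le_pos; assumption).
  assert (HM2 : 0 <= M ^ 2) by apply pow2_ge_0.
  pose proof (Rmult_le_pos _ _ HMG Hdz).
  pose proof (Rmult_le_pos _ _ HM2 Hdz).
  pose proof (Rmult_le_pos _ _ Hl Hsd).
  lra.
Qed.

Lemma small_radius (A : R) :
  0 <= A -> exists rho, 0 < rho <= 1 /\ A * rho <= 1.
Proof.
  intros HA; exists (/ (A + 1)).
  assert (H : 0 < / (A + 1)) by (apply Rinv_0_lt_compat; lra).
  assert (E : (A + 1) * / (A + 1) = 1) by (field; lra).
  nra.
Qed.

(** * Existence *)

Theorem theorem4p1 :
  forall z0 : R, 0 < z0 ->
  exists rho : R, 0 < rho /\
  exists z z1 z2 : R -> R,
    C2_on 0 rho z z1 z2 /\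
    (forall r : R, 0 <= r <= rho -> 0 < z r) /\
    (forall r : R, 0 < r <= rho ->
       z r / 2 *
         (z2 r / Rpower (1 + z1 r ^ 2) (3 / 2)
          + z1 r / (r * Rpower (1 + z1 r ^ 2) (1 / 2)))
       + 1 / Rpower (1 + z1 r ^ 2) (1 / 2)
       = 1 / (z r * Rpower (1 + z1 r ^ 2) (1 / 2))) /\
    z 0 = z0 /\ z1 0 = 0.
Proof.
  intros z0 Hz0.
  set (a := 2 / z0).
  assert (Ha : 0 < a) by (apply Rdiv_lt_0_compat; lra).
  set (G := 2 * a ^ 2 + 2 * a).
  assert (HG : 0 < G) by (unfold G; nra).
  (* The bound 2 G + M on the right side gives |q| <= G + M / 2, which the
     truncation level must dominate. *)
  set (M := 2 * G).
  set (L := 2 * ((4 * a + 2) * a ^ 2) + 2 * M * G + 3 * M ^ 2).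
  assert (HM : 0 < M) by (unfold M; lra).
  assert (HMG : 0 < M * G) by nra.
  assert (HM2 : 0 < M ^ 2) by nra.
  assert (HL : 0 <= L) by (unfold L; nra).
  assert (HMa : 0 < M * a) by nra.
  (* In rho * (3 L + M + M a) <= 1 the terms give, in this order, the
     contraction, the hypothesis s M <= 1 of the bounds on the right side, and
     |z - z0| <= z0 / 2. *)
  destruct (small_radius (3 * L + M + M * a)) as [rho [Hrho Hsmall]]; [lra|].
  assert (HLr : 0 <= L * rho) by nra.
  assert (HMr : 0 <= M * rho) by nra.
  assert (HMar : 0 <= M * a * rho) by nra.
  destruct (singular_picard (trunc_rhs z0 M) z0 (2 * G + M) L rho)
    as [q [h [Hq [Hh [HF [Hqh Hqb]]]]]].
  - lra.
  - lra.
  - exact HL.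
  - nra.
  - intros; apply trunc_rhs_continuity; assumption.
  - intros s z q Hs; apply trunc_rhs_bound; nra.
  - intros s z q z' q' Hs; apply trunc_rhs_lipschitz; nra.
  - assert (HqM : forall r, Rabs (q r) <= M).
    { intros r; specialize (Hqb r); unfold M in *; lra. }
    assert (Hz : forall r, 0 <= r <= rho -> z0 / 2 <= z0 + moment q r <= 2 * z0).
    { intros r Hr.
      pose proof (moment_abs q M r Hq (proj1 Hr) (fun s _ => HqM s)) as Hm.
      assert (Hr2 : r ^ 2 <= rho) by nra.
      assert (Hb : M * (r ^ 2 / 2) <= z0 / 2).
      { assert (M * a * rho <= 1) by lra.
        assert (E : a * z0 = 2) by (unfold a; field; lra).
        nra. }
      apply Rabs_le_between in Hm; lra. }
    exists rho; split; [lra|].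
    exists (fun r => z0 + moment q r), (fun r => r * q r), (fun r => h r - q r).
    split; [|split; [|split; [|split]]].
    + intros r Hr; unfold cc_interval in Hr; split; [|split].
      * apply is_derive_D_in.
        replace (r * q r) with (0 + r * q r) by ring.
        apply (@is_derive_plus R_AbsRing R_NormedModule (fun _ => z0) (moment q)).
        -- apply (@is_derive_const R_AbsRing R_NormedModule).
        -- apply moment_derive, Hq.
      * apply is_derive_D_in.
        apply slope_derive; [exact Hq | exact Hh | exact Hqh | lra].
      * apply continuity_continue_in, continuity_sub; assumption.
    + intros r Hr; specialize (Hz r Hr); lra.
    + intros r Hr.
      assert (Hr' : 0 <= r <= rho) by lra.
      specialize (Hz r Hr'); specialize (HF r Hr').
      unfold trunc_rhs in HF.
      rewrite (clamp_id _ _ _ Hz) in HF.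
      rewrite (clamp_id (- M) M (q r)) in HF by (apply Rabs_le_between, HqM).
      set (z := z0 + moment q r) in *.
      set (W := 1 + (r * q r) ^ 2).
      assert (HW : 0 < W) by (unfold W; nra).
      (* One power of 1 + z'^2 is split off, so that only its square root
         remains as an atom for [field]. *)
      replace (3 / 2) with (1 + 1 / 2) by field.
      rewrite Rpower_plus, Rpower_1 by exact HW.
      assert (HS : 0 < Rpower W (1 / 2)) by apply exp_pos.
      set (S := Rpower W (1 / 2)) in *.
      assert (Hode : h r - q r = W * (2 * (/ z) ^ 2 - 2 * / z - q r)).
      { rewrite HF; unfold W; ring. }
      rewrite Hode; field; repeat split; lra.
    + rewrite moment_0; ring.
    + ring.
Qed.
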